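(* Let $E\in M(B\otimes C)$ be a regular separability idempotent, $(A,\Delta)$ the associated weak multiplier Hopf algebra with $A=C\otimes B$, and $\widehat A$ its dual, whose elements are linear combinations of the elements $u\diamond v$ with $u\in B$, $v\in C$. For all $u,u'\in B$ and $v,v'\in C$, the product in $\widehat A$ satisfies $$(u\diamond v)(u'\diamond v')=\varepsilon(vu')\,u\diamond v',$$ where $\varepsilon$ is the counit of $A$.
   Context: Algebras are over $\mathbb C$, not necessarily unital, with non-degenerate product and idempotent; $M(\cdot)$ denotes the multiplier algebra. Let $B,C$ be such algebras. A regular separability idempotent is an idempotent $E\in M(B\otimes C)$ such that: (i) $E(1\otimes c)$ and $(b\otimes 1)E$ lie in $B\otimes C$ for all $b\in B,c\in C$; (ii) $E$ is full: $B$ is the smallest subspace $V$ with $E(1\otimes c)\in V\otimes C$ for all $c$, and $C$ is the smallest subspace $W$ with $(b\otimes 1)E\in B\otimes W$ for all $b$; (iii) there are anti-isomorphisms $S_B:B\to C$ and $S_C:C\to B$ with $E(b\otimes 1)=E(1\otimes S_B(b))$ and $(1\otimes c)E=(S_C(c)\otimes 1)E$. There are unique linear functionals $\varphi_B$ on $B$, $\varphi_C$ on $C$ with $(\varphi_B\otimes\iota)(E(1\otimes c))=c$ and $(\iota\otimes\varphi_C)((b\otimes 1)E)=b$. Known facts: they are faithful; $\varphi_B(bb')=\varphi_B(b'\sigma_B(b))$ with $\sigma_B=(S_CS_B)^{-1}$; $\varphi_C(cc')=\varphi_C(c'\sigma_C(c))$ with $\sigma_C=S_BS_C$; $\varphi_C=\varphi_B\circ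 S_C$, $\varphi_B=\varphi_C\circ S_B$; $(S_B\otimes S_C)E=\zeta E$ ($\zeta$ the flip). $A=C\otimes B$; $B$ and $C$ are identified with commuting subalgebras of $M(A)$, so $A$ is spanned by elements $cb=bc$. The coproduct $\Delta:A\to M(A\otimes A)$ is $\Delta(cb)=(c\otimes 1)E(1\otimes b)$. The counit is $\varepsilon(cb)=\varphi_B(S_C(c)b)=\varphi_C(cS_B(b))$. Let $\varphi$ be the faithful functional $\varphi(cb)=\varphi_C(c)\varphi_B(b)$ on $A$ and $\widehat A=\{\varphi(\,\cdot\,a): a\in A\}$. The product on $\widehat A$ is dual to $\Delta$: $(\omega\omega')(a)=(\omega\otimes\omega')(\Delta(a))$, where for $\omega=\varphi(\,\cdot\,p)$, $\omega'=\varphi(\,\cdot\,q)$ and $m\in M(A\otimes A)$ one puts $(\omega\otimes\omega')(m)=(\varphi\otimes\varphi)(m(p\otimes q))$. For $u\in B$, $v\in C$, $u\diamond v$ denotes the functional in $\widehat A$ given by $\langle cb,u\diamond v\rangle=\varphi_B(bS_C(v))\,\varphi_C(S_B(u)c)$; the map $u\otimes v\mapsto u\diamond v$ is a linear isomorphism $B\otimes C\to\widehat A$. *)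

(* Defs.v *)
From HB Require Import structures.
From mathcomp Require Import all_boot all_order all_algebra.
From mathcomp Require Import generic_quotient boolp classical_sets reals complex.

Set Implicit Arguments.
Unset Strict Implicit.
Unset Printing Implicit Defensive.

Import GRing.Theory.
Local Open Scope ring_scope.
Local Open Scope quotient_scope.

Reserved Notation "U ⊗ V" (at level 40, left associativity).
Reserved Notation "x ** y" (at level 40, left associativity).

Section LinearPredicate.
Variables (K : fieldType) (U V W : lmodType K).

Definition bilinear_map (f : U -> V -> W) :=
  (forall v, linear (f^~ v)) /\ (forall u, linear (f u)).

Lemma linD (f : U -> V) : linear f -> forall x y, f (x + y) = f x + f y.
Proof. by move=> lf x y; have := lf 1 x y; rewrite !scale1r. Qed.

Lemma lin0 (f : U -> V) : linear f -> f 0 = 0.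
Proof.
move=> lf; have /eqP := linD lf 0 0.
by rewrite addr0 -subr_eq subrr eq_sym => /eqP.
Qed.

Lemma linZ (f : U -> V) : linear f -> forall a x, f (a *: x) = a *: f x.
Proof. by move=> lf a x; have := lf a x 0; rewrite !addr0 (lin0 lf) addr0. Qed.

Lemma linB (f : U -> V) : linear f -> forall x y, f (x - y) = f x - f y.
Proof. by move=> lf x y; rewrite (linD lf) -scaleN1r (linZ lf) scaleN1r. Qed.

Lemma lin_sum (f : U -> V) I (r : seq I) (F : I -> U) :
  linear f -> f (\sum_(i <- r) F i) = \sum_(i <- r) f (F i).
Proof.
move=> lf; elim: r => [|i r IH]; first by rewrite !big_nil (lin0 lf).
by rewrite !big_cons (linD lf) IH.
Qed.

Lemma lin_comp (g : V -> W) (f : U -> V) :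
  linear g -> linear f -> linear (fun x => g (f x)).
Proof. by move=> lg lf a x y; rewrite lf lg. Qed.

End LinearPredicate.

Lemma id_linear (K : fieldType) (X : lmodType K) : linear (@id X).
Proof. by []. Qed.
Arguments id_linear {K} X.

(* The algebraic tensor product: formal sums of pairs, two of them being
   identified when every bilinear map gives them the same value.  Scalars are
   absorbed in the pairs, so lists of pairs are enough.  The universal property
   is given by lemmas tlift_linear, tlift_pure and tens_ext below. *)
Section Tensor.
Variables (K : fieldType) (U V : lmodType K).

Definition sum_along (W : lmodType K) (f : U -> V -> W) (s : seq (U * V)) : W :=
  \sum_(x <- s) f x.1 x.2.

Definition tens_eqv (s t : seq (U * V)) : bool :=
  `[< forall (W : lmodType K) (f : U -> V -> W),
        bilinear_map f -> sum_along f s = sum_along f t >].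

Lemma tens_eqv_equiv : equiv_class_of tens_eqv.
Proof.
split=> [s|s t|t s r].
- by apply/asboolP.
- by apply/asboolP/asboolP => h W f bf; rewrite h.
- by move=> /asboolP h1 /asboolP h2; apply/asboolP => W f bf; rewrite h1 ?h2.
Qed.

Canonical tens_equiv := EquivRelPack tens_eqv_equiv.

Definition tensor := {eq_quot tens_equiv}.
HB.instance Definition _ := Choice.on tensor.
HB.instance Definition _ := EqQuotient.on tensor.

Definition tpure (u : U) (v : V) : tensor := \pi_tensor [:: (u, v)].

Definition tlift (W : lmodType K) (f : U -> V -> W) (t : tensor) : W :=
  sum_along f (repr t).

Lemma tpiP s t : tens_eqv s t -> \pi_tensor s = \pi_tensor t.
Proof. by move=> h; apply/eqmodP. Qed.

Lemma sum_along_repr (W : lmodType K) (f : U -> V -> W) s :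
  bilinear_map f -> sum_along f (repr (\pi_tensor s)) = sum_along f s.
Proof.
move=> bf; have : repr (\pi_tensor s) = s %[mod tensor] by rewrite reprK.
by move=> /eqmodP /asboolP; apply.
Qed.

Lemma tlift_pi (W : lmodType K) (f : U -> V -> W) s :
  bilinear_map f -> tlift f (\pi_tensor s) = sum_along f s.
Proof. exact: sum_along_repr. Qed.

Definition tens_zero : tensor := \pi_tensor [::].
Definition tens_add (s t : tensor) : tensor := \pi_tensor (repr s ++ repr t).
Definition tens_scale (a : K) (t : tensor) : tensor :=
  \pi_tensor [seq (a *: x.1, x.2) | x <- repr t].
Definition tens_opp (t : tensor) : tensor := tens_scale (-1) t.

Lemma sum_along_cat (W : lmodType K) (f : U -> V -> W) s t :
  sum_along f (s ++ t) = sum_along f s + sum_along f t.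
Proof. exact: big_cat. Qed.

Lemma sum_along_scale (W : lmodType K) (f : U -> V -> W) a s : bilinear_map f ->
  sum_along f [seq (a *: x.1, x.2) | x <- s] = a *: sum_along f s.
Proof.
move=> [f1 _]; rewrite /sum_along big_map scaler_sumr.
by apply: eq_bigr => -[u v] _ /=; rewrite (linZ (f1 v)).
Qed.

Lemma tensor_eqP (s t : tensor) :
  (forall (W : lmodType K) (f : U -> V -> W),
     bilinear_map f -> tlift f s = tlift f t) -> s = t.
Proof.
by move=> h; rewrite -[s]reprK -[t]reprK; apply: tpiP; apply/asboolP.
Qed.

Lemma tlift_add0 (W : lmodType K) (f : U -> V -> W) s t : bilinear_map f ->
  tlift f (tens_add s t) = tlift f s + tlift f t.
Proof. by move=> bf; rewrite /tlift sum_along_repr // sum_along_cat. Qed.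

Lemma tlift_scale0 (W : lmodType K) (f : U -> V -> W) a t : bilinear_map f ->
  tlift f (tens_scale a t) = a *: tlift f t.
Proof. by move=> bf; rewrite /tlift sum_along_repr // sum_along_scale. Qed.

Lemma tlift_zero0 (W : lmodType K) (f : U -> V -> W) : bilinear_map f -> tlift f tens_zero = 0.
Proof. by move=> bf; rewrite /tlift sum_along_repr // /sum_along big_nil. Qed.

Lemma tens_addA : associative tens_add.
Proof. by move=> x y z; apply: tensor_eqP => W f bf; rewrite !tlift_add0 // addrA. Qed.
Lemma tens_addC : commutative tens_add.
Proof. by move=> x y; apply: tensor_eqP => W f bf; rewrite !tlift_add0 // addrC. Qed.
Lemma tens_add0 : left_id tens_zero tens_add.
Proof.
by move=> x; apply: tensor_eqP => W f bf; rewrite tlift_add0 // tlift_zero0 // add0r.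
Qed.
Lemma tens_addN : left_inverse tens_zero tens_opp tens_add.
Proof.
move=> x; apply: tensor_eqP => W f bf.
by rewrite tlift_add0 // tlift_scale0 // tlift_zero0 // scaleN1r addNr.
Qed.

HB.instance Definition _ :=
  GRing.isZmodule.Build tensor tens_addA tens_addC tens_add0 tens_addN.

Lemma tens_scaleA a b t : tens_scale a (tens_scale b t) = tens_scale (a * b) t.
Proof. by apply: tensor_eqP => W f bf; rewrite !tlift_scale0 // scalerA. Qed.
Lemma tens_scale1 : left_id 1 tens_scale.
Proof. by move=> t; apply: tensor_eqP => W f bf; rewrite tlift_scale0 // scale1r. Qed.
Lemma tens_scaleDr : right_distributive tens_scale +%R.
Proof.
move=> a s t; apply: tensor_eqP => W f bf.
by rewrite tlift_scale0 // !tlift_add0 // !tlift_scale0 // scalerDr.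
Qed.
Lemma tens_scaleDl t : {morph tens_scale^~ t : a b / a + b}.
Proof.
move=> a b; apply: tensor_eqP => W f bf.
by rewrite tlift_add0 // !tlift_scale0 // scalerDl.
Qed.

HB.instance Definition _ := GRing.Zmodule_isLmodule.Build K tensor
  tens_scaleA tens_scale1 tens_scaleDr tens_scaleDl.

Lemma tlift_linear (W : lmodType K) (f : U -> V -> W) :
  bilinear_map f -> linear (tlift f).
Proof.
by move=> bf a s t; rewrite [LHS]tlift_add0 // [in LHS]tlift_scale0.
Qed.

Lemma tlift_pure (W : lmodType K) (f : U -> V -> W) u v :
  bilinear_map f -> tlift f (tpure u v) = f u v.
Proof. by move=> bf; rewrite tlift_pi // /sum_along big_seq1. Qed.

Lemma tpure_bilin : bilinear_map tpure.
Proof.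
split=> [v a u u'|u a v v']; apply: tensor_eqP => W f bf.
  by rewrite (tlift_linear bf) !tlift_pure // bf.1.
by rewrite (tlift_linear bf) !tlift_pure // bf.2.
Qed.

Lemma tens_sum (t : tensor) : t = \sum_(x <- repr t) tpure x.1 x.2.
Proof.
apply: tensor_eqP => W f bf; rewrite (lin_sum _ _ (tlift_linear bf)).
by apply: eq_bigr => x _; rewrite tlift_pure.
Qed.

Lemma tens_ext (W : lmodType K) (f g : tensor -> W) : linear f -> linear g ->
  (forall u v, f (tpure u v) = g (tpure u v)) -> forall t, f t = g t.
Proof.
move=> lf lg h t; rewrite [t]tens_sum (lin_sum _ _ lf) (lin_sum _ _ lg).
by apply: eq_bigr => x _; rewrite h.
Qed.

Lemma tlift_lin_arg (W : lmodType K) a (f g h : U -> V -> W) t :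
  (forall u v, f u v = a *: g u v + h u v) ->
  tlift f t = a *: tlift g t + tlift h t.
Proof.
move=> fgh; rewrite /tlift /sum_along scaler_sumr -big_split /=.
by apply: eq_bigr => x _; rewrite fgh.
Qed.

End Tensor.

Arguments tensor [K] (U V)%_type_scope.
Notation "U ⊗ V" := (tensor U V) : type_scope.
Notation "u ⊗ v" := (tpure u v) : ring_scope.

(* The image of V1 (x) V2 in U (x) V, for subspaces V1 of U and V2 of V. *)
Definition in_tens (K : fieldType) (U V : lmodType K)
    (V1 : U -> Prop) (V2 : V -> Prop) (t : U ⊗ V) : Prop :=
  exists2 s : seq (U * V), (forall x, x \in s -> V1 x.1 /\ V2 x.2)
                         & t = \sum_(x <- s) (x.1 ⊗ x.2).

Definition is_subspace (K : fieldType) (U : lmodType K) (V : U -> Prop) :=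
  V 0 /\ forall a x y, V x -> V y -> V (a *: x + y).

(* Associative algebras over K, not necessarily unital. *)
HB.mixin Record Lmodule_isNuAlg (K : fieldType) V of GRing.Lmodule K V := {
  amul : V -> V -> V;
  amulA : associative amul;
  amul_bilin : bilinear_map amul
}.

#[short(type="nuAlgType")]
HB.structure Definition NuAlg (K : fieldType) :=
  {V of GRing.Lmodule K V & Lmodule_isNuAlg K V}.

Notation "x ** y" := (amul x y) : ring_scope.

Section AlgebraPredicates.
Variables (K : fieldType) (A : nuAlgType K).

Definition nondegenerate_algebra :=
  (forall a : A, (forall b : A, a ** b = 0) -> a = 0) /\
  (forall a : A, (forall b : A, b ** a = 0) -> a = 0).

Definition idempotent_algebra :=
  forall a : A, exists s : seq (A * A), a = \sum_(x <- s) x.1 ** x.2.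

Lemma amul_linl (y : A) : linear (fun x : A => x ** y).
Proof. exact: (amul_bilin (s := A)).1. Qed.
Lemma amul_linr (x : A) : linear (fun y : A => x ** y).
Proof. exact: (amul_bilin (s := A)).2. Qed.

End AlgebraPredicates.

Arguments nondegenerate_algebra {K} A%_type_scope.
Arguments idempotent_algebra {K} A%_type_scope.

Definition anti_isomorphism (K : fieldType) (A B : nuAlgType K) (S : A -> B) :=
  [/\ linear S, bijective S & forall x y, S (x ** y) = S y ** S x].

Section TensorAlgebra.
Variables (K : fieldType) (A B : nuAlgType K).

Definition tens_mul (s t : A ⊗ B) : A ⊗ B :=
  tlift (fun a b => tlift (fun a' b' => (a ** a') ⊗ (b ** b')) t) s.

Lemma tens_mul_bil2 (a : A) (b : B) :
  bilinear_map (fun a' b' => (a ** a') ⊗ (b ** b')).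
Proof.
split=> [b' | a'] k x y.
  by rewrite amul_linr (tpure_bilin A B).1.
by rewrite amul_linr (tpure_bilin A B).2.
Qed.

Lemma tens_mul_bil1 (t : A ⊗ B) :
  bilinear_map (fun a b => tlift (fun a' b' => (a ** a') ⊗ (b ** b')) t).
Proof.
split=> [b | a] k x y; apply: tlift_lin_arg => a' b'.
  by rewrite amul_linl (tpure_bilin A B).1.
by rewrite amul_linl (tpure_bilin A B).2.
Qed.

Lemma tens_mul_bilin : bilinear_map tens_mul.
Proof.
split=> [t | s]; first exact: tlift_linear (tens_mul_bil1 t).
move=> k x y; apply: tlift_lin_arg => a b.
by rewrite (tlift_linear (tens_mul_bil2 a b)).
Qed.

Lemma tens_mul_pure a b a' b' :
  tens_mul (a ⊗ b) (a' ⊗ b') = (a ** a') ⊗ (b ** b').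
Proof.
rewrite /tens_mul tlift_pure; last exact: tens_mul_bil1.
by rewrite tlift_pure //; exact: tens_mul_bil2.
Qed.

Lemma tens_mulA : associative tens_mul.
Proof.
have [b1 b2] := tens_mul_bilin.
move=> x y z; move: x.
apply: tens_ext; [exact: b1 | exact: lin_comp (b1 z) (b1 y) | move=> a b].
move: y; apply: tens_ext.
- exact: lin_comp (b2 _) (b1 z).
- exact: lin_comp (b1 z) (b2 _).
move=> a' b'; move: z; apply: tens_ext.
- exact: lin_comp (b2 _) (b2 _).
- exact: b2.
by move=> a'' b''; rewrite !tens_mul_pure !amulA.
Qed.

HB.instance Definition _ :=
  Lmodule_isNuAlg.Build K (A ⊗ B)%type tens_mulA tens_mul_bilin.

Lemma amul_pure (a a' : A) (b b' : B) :
  (a ⊗ b) ** (a' ⊗ b') = (a ** a') ⊗ (b ** b').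
Proof. exact: tens_mul_pure. Qed.

End TensorAlgebra.

(* The multiplier algebra M(A), as the algebra of double centralizers: the
   multiplier m is given by x |-> m x (field mL) and x |-> x m (field mR). *)
Section Multiplier.
Local Obligation Tactic := idtac.
Variables (K : fieldType) (A : nuAlgType K).

Record multiplier := Multiplier {
  mL : A -> A;
  mR : A -> A;
  mL_linear : linear mL;
  mR_linear : linear mR;
  mL_mul : forall x y, mL (x ** y) = mL x ** y;
  mR_mul : forall x y, mR (x ** y) = x ** mR y;
  mRL : forall x y, mR x ** y = x ** mL y
}.

Lemma multiplier_ext (m n : multiplier) : mL m =1 mL n -> mR m =1 mR n -> m = n.
Proof.
case: m n => [l r a1 a2 a3 a4 a5] [l' r' b1 b2 b3 b4 b5] /= /funext e1 /funext e2.
by subst l' r'; congr Multiplier; exact: Prop_irrelevance.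
Qed.

HB.instance Definition _ := gen_eqMixin multiplier.
HB.instance Definition _ := gen_choiceMixin multiplier.

Lemma amul0l (x : A) : 0 ** x = 0. Proof. exact: lin0 (amul_linl x). Qed.
Lemma amul0r (x : A) : x ** 0 = 0. Proof. exact: lin0 (amul_linr x). Qed.
Lemma amulDl (x y z : A) : (x + y) ** z = x ** z + y ** z.
Proof. exact: linD (amul_linl z) _ _. Qed.
Lemma amulDr (x y z : A) : z ** (x + y) = z ** x + z ** y.
Proof. exact: linD (amul_linr z) _ _. Qed.
Lemma amulZl k (x y : A) : (k *: x) ** y = k *: (x ** y).
Proof. exact: linZ (amul_linl y) _ _. Qed.
Lemma amulZr k (x y : A) : x ** (k *: y) = k *: (x ** y).
Proof. exact: linZ (amul_linr x) _ _. Qed.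

Program Definition mzero : multiplier :=
  @Multiplier (fun=> 0) (fun=> 0) _ _ _ _ _.
Next Obligation. by move=> k x y /=; rewrite scaler0 addr0. Qed.
Next Obligation. by move=> k x y /=; rewrite scaler0 addr0. Qed.
Next Obligation. by move=> x y /=; rewrite amul0l. Qed.
Next Obligation. by move=> x y /=; rewrite amul0r. Qed.
Next Obligation. by move=> x y /=; rewrite amul0l amul0r. Qed.

Program Definition madd (m n : multiplier) : multiplier :=
  @Multiplier (fun x => mL m x + mL n x) (fun x => mR m x + mR n x) _ _ _ _ _.
Next Obligation. by move=> m n k x y /=; rewrite !mL_linear scalerDr addrACA. Qed.
Next Obligation. by move=> m n k x y /=; rewrite !mR_linear scalerDr addrACA. Qed.
Next Obligation. by move=> m n x y /=; rewrite !mL_mul amulDl. Qed.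
Next Obligation. by move=> m n x y /=; rewrite !mR_mul amulDr. Qed.
Next Obligation. by move=> m n x y /=; rewrite amulDl amulDr !mRL. Qed.

Program Definition mscale (k : K) (m : multiplier) : multiplier :=
  @Multiplier (fun x => k *: mL m x) (fun x => k *: mR m x) _ _ _ _ _.
Next Obligation.
by move=> k m l x y /=; rewrite !mL_linear scalerDr !scalerA [k * _]mulrC.
Qed.
Next Obligation.
by move=> k m l x y /=; rewrite !mR_linear scalerDr !scalerA [k * _]mulrC.
Qed.
Next Obligation. by move=> k m x y /=; rewrite !mL_mul amulZl. Qed.
Next Obligation. by move=> k m x y /=; rewrite !mR_mul amulZr. Qed.
Next Obligation. by move=> k m x y /=; rewrite amulZl amulZr !mRL. Qed.

Program Definition mmul (m n : multiplier) : multiplier :=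
  @Multiplier (fun x => mL m (mL n x)) (fun x => mR n (mR m x)) _ _ _ _ _.
Next Obligation. by move=> m n k x y /=; rewrite !mL_linear. Qed.
Next Obligation. by move=> m n k x y /=; rewrite !mR_linear. Qed.
Next Obligation. by move=> m n x y /=; rewrite !mL_mul. Qed.
Next Obligation. by move=> m n x y /=; rewrite !mR_mul. Qed.
Next Obligation. by move=> m n x y /=; rewrite !mRL. Qed.

Definition mone : multiplier :=
  @Multiplier id id (fun _ _ _ => erefl) (fun _ _ _ => erefl)
    (fun _ _ => erefl) (fun _ _ => erefl) (fun _ _ => erefl).

Program Definition mof (a : A) : multiplier :=
  @Multiplier (fun x => a ** x) (fun x => x ** a) _ _ _ _ _.
Next Obligation. by move=> a; exact: amul_linr. Qed.
Next Obligation. by move=> a; exact: amul_linl. Qed.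
Next Obligation. by move=> a x y /=; rewrite amulA. Qed.
Next Obligation. by move=> a x y /=; rewrite amulA. Qed.
Next Obligation. by move=> a x y /=; rewrite amulA. Qed.

Definition mopp (m : multiplier) := mscale (-1) m.

Lemma maddA : associative madd.
Proof. by move=> m n p; apply: multiplier_ext => x /=; rewrite addrA. Qed.
Lemma maddC : commutative madd.
Proof. by move=> m n; apply: multiplier_ext => x /=; rewrite addrC. Qed.
Lemma madd0 : left_id mzero madd.
Proof. by move=> m; apply: multiplier_ext => x /=; rewrite add0r. Qed.
Lemma maddN : left_inverse mzero mopp madd.
Proof. by move=> m; apply: multiplier_ext => x /=; rewrite scaleN1r addNr. Qed.

HB.instance Definition _ := GRing.isZmodule.Build multiplier maddA maddC madd0 maddN.

Lemma mscaleA k l m : mscale k (mscale l m) = mscale (k * l) m.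
Proof. by apply: multiplier_ext => x /=; rewrite scalerA. Qed.
Lemma mscale1 : left_id 1 mscale.
Proof. by move=> m; apply: multiplier_ext => x /=; rewrite scale1r. Qed.
Lemma mscaleDr : right_distributive mscale +%R.
Proof. by move=> k m n; apply: multiplier_ext => x /=; rewrite scalerDr. Qed.
Lemma mscaleDl m : {morph mscale^~ m : k l / k + l}.
Proof. by move=> k l; apply: multiplier_ext => x /=; rewrite scalerDl. Qed.

HB.instance Definition _ := GRing.Zmodule_isLmodule.Build K multiplier
  mscaleA mscale1 mscaleDr mscaleDl.

Lemma mmulA : associative mmul.
Proof. by move=> m n p; apply: multiplier_ext. Qed.
Lemma mmul_bilin : bilinear_map mmul.
Proof.
split=> [n k m m' | m k n n']; apply: multiplier_ext => x //=.
  by rewrite mR_linear.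
by rewrite mL_linear.
Qed.

HB.instance Definition _ := Lmodule_isNuAlg.Build K multiplier mmulA mmul_bilin.

End Multiplier.

Arguments multiplier {K} A%_type_scope.
Arguments mone {K A}.

(* The canonical map M(A) x M(B) -> M(A (x) B). *)
Section TensorMultiplier.
Local Obligation Tactic := idtac.
Variables (K : fieldType) (A B : nuAlgType K).

Lemma tens_map_bilin (A' B' : nuAlgType K) (f : A -> A') (g : B -> B') :
  linear f -> linear g -> bilinear_map (fun a b => f a ⊗ g b).
Proof.
move=> lf lg; split=> [b | a] k x y.
  by rewrite lf (tpure_bilin _ _).1.
by rewrite lg (tpure_bilin _ _).2.
Qed.

Definition tmapL (f : A -> A) (g : B -> B) : A ⊗ B -> A ⊗ B :=
  tlift (fun a b => f a ⊗ g b).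

Lemma tmapL_linear f g : linear f -> linear g -> linear (tmapL f g).
Proof. by move=> lf lg; apply: tlift_linear; exact: tens_map_bilin. Qed.
Lemma tmapL_pure f g a b : linear f -> linear g -> tmapL f g (a ⊗ b) = f a ⊗ g b.
Proof. by move=> lf lg; rewrite /tmapL tlift_pure //; exact: tens_map_bilin. Qed.

Lemma tens_ext2 (W : lmodType K) (F G : A ⊗ B -> A ⊗ B -> W) :
  bilinear_map F -> bilinear_map G ->
  (forall a b a' b', F (a ⊗ b) (a' ⊗ b') = G (a ⊗ b) (a' ⊗ b')) ->
  forall x y, F x y = G x y.
Proof.
move=> [F1 F2] [G1 G2] h x y; move: x; apply: tens_ext => // a b.
by move: y; apply: tens_ext.
Qed.

Lemma bilin_precomp2 (X Y X' Y' Z : lmodType K) (F : X -> Y -> Z)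
    (f : X' -> X) (g : Y' -> Y) :
  bilinear_map F -> linear f -> linear g ->
  bilinear_map (fun x y => F (f x) (g y)).
Proof.
by move=> [F1 F2] lf lg; split=> [y | x] k u v; rewrite ?lf ?lg ?F1 ?F2.
Qed.

Lemma bilin_postcomp (X Y Z W : lmodType K) (F : X -> Y -> Z) (h : Z -> W) :
  bilinear_map F -> linear h -> bilinear_map (fun x y => h (F x y)).
Proof.
by move=> [F1 F2] lh; split=> [y | x] k u v; rewrite ?F1 ?F2 lh.
Qed.

Program Definition mtens (m : multiplier A) (n : multiplier B) :
    multiplier (A ⊗ B) :=
  @Multiplier _ _ (tmapL (mL m) (mL n)) (tmapL (mR m) (mR n)) _ _ _ _ _.
Next Obligation. by move=> m n; apply: tmapL_linear; exact: mL_linear. Qed.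
Next Obligation. by move=> m n; apply: tmapL_linear; exact: mR_linear. Qed.
Next Obligation.
move=> m n x y /=.
have lm : linear (tmapL (mL m) (mL n)) by apply: tmapL_linear; exact: mL_linear.
move: x y; apply: tens_ext2.
- exact: bilin_postcomp (amul_bilin (s := (A ⊗ B)%type)) lm.
- exact: bilin_precomp2 (amul_bilin (s := (A ⊗ B)%type)) lm (id_linear _).
move=> a b a' b'; rewrite amul_pure !tmapL_pure; try exact: mL_linear.
by rewrite amul_pure !mL_mul.
Qed.
Next Obligation.
move=> m n x y /=.
have lm : linear (tmapL (mR m) (mR n)) by apply: tmapL_linear; exact: mR_linear.
move: x y; apply: tens_ext2.
- exact: bilin_postcomp (amul_bilin (s := (A ⊗ B)%type)) lm.
- exact: bilin_precomp2 (amul_bilin (s := (A ⊗ B)%type)) (id_linear _) lm.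
move=> a b a' b'; rewrite amul_pure !tmapL_pure; try exact: mR_linear.
by rewrite amul_pure !mR_mul.
Qed.
Next Obligation.
move=> m n x y /=.
have lm : linear (tmapL (mL m) (mL n)) by apply: tmapL_linear; exact: mL_linear.
have lr : linear (tmapL (mR m) (mR n)) by apply: tmapL_linear; exact: mR_linear.
move: x y; apply: tens_ext2.
- exact: bilin_precomp2 (amul_bilin (s := (A ⊗ B)%type)) lr (id_linear _).
- exact: bilin_precomp2 (amul_bilin (s := (A ⊗ B)%type)) (id_linear _) lm.
move=> a b a' b'; rewrite !tmapL_pure; try exact: mL_linear; try exact: mR_linear.
by rewrite !amul_pure !mRL.
Qed.

End TensorMultiplier.

Definition leg1 (K : fieldType) (A B : nuAlgType K) (m : multiplier A) :
  multiplier (A ⊗ B) := mtens m mone.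
Definition leg2 (K : fieldType) (A B : nuAlgType K) (n : multiplier B) :
  multiplier (A ⊗ B) := mtens mone n.

Arguments leg1 {K A B} m.
Arguments leg2 {K A B} n.

Section LegEmbedding.
Local Obligation Tactic := idtac.
Variables (K : fieldType) (B C : nuAlgType K).

Let AA := ((C ⊗ B) ⊗ (C ⊗ B))%type.

Definition mid (c : C) (b : B) : B ⊗ C -> AA :=
  tlift (fun b' c' => (c ⊗ b') ⊗ (c' ⊗ b)).

(* A linear operator T on B (x) C, acting on the two middle factors of
   C (x) B (x) C (x) B. *)
Definition mid_map (T : B ⊗ C -> B ⊗ C) : AA -> AA :=
  tlift (fun x y : C ⊗ B =>
    tlift (fun c b => tlift (fun c' b' => mid c b' (T (b ⊗ c'))) y) x).

Lemma mid_bilin c b :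
  bilinear_map (fun b' c' => (c ⊗ b') ⊗ (c' ⊗ b) : AA).
Proof.
split=> [c' | b'] k x y.
  by rewrite (tpure_bilin C B).2 (tpure_bilin _ _).1.
by rewrite (tpure_bilin C B).1 (tpure_bilin _ _).2.
Qed.

Lemma mid_linear c b : linear (mid c b).
Proof. exact: tlift_linear (mid_bilin c b). Qed.

Lemma mid_pure c b b' c' : mid c b (b' ⊗ c') = (c ⊗ b') ⊗ (c' ⊗ b).
Proof. exact: tlift_pure (mid_bilin c b). Qed.

Lemma mid_bilin_arg t : bilinear_map (fun c b => mid c b t).
Proof.
split=> [b | c] k x y; apply: tlift_lin_arg => b' c'.
  by rewrite (tpure_bilin C B).1 (tpure_bilin _ _).1.
by rewrite (tpure_bilin C B).2 (tpure_bilin _ _).2.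
Qed.

Lemma mid_mul c b c' b' s t :
  mid c b s ** mid c' b' t = mid (c ** c') (b ** b') (s ** t).
Proof.
move: s t; apply: tens_ext2.
- exact: bilin_precomp2 (amul_bilin (s := AA)) (mid_linear _ _) (mid_linear _ _).
- exact: bilin_postcomp (amul_bilin (s := (B ⊗ C)%type)) (mid_linear _ _).
by move=> *; rewrite amul_pure !mid_pure !amul_pure.
Qed.

Section MidMap.
Variables (T : B ⊗ C -> B ⊗ C) (lT : linear T).

Let bil1 c b : bilinear_map (fun c' b' => mid c b' (T (b ⊗ c'))).
Proof.
split=> [b' | c'] k x y; last by rewrite (mid_bilin_arg _).2.
by rewrite (tpure_bilin B C).2 lT mid_linear.
Qed.

Let bil2 y : bilinear_map
  (fun c b => tlift (fun c' b' => mid c b' (T (b ⊗ c'))) y).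
Proof.
split=> [b | c] k u v; apply: tlift_lin_arg => c' b'.
  by rewrite (mid_bilin_arg _).1.
by rewrite (tpure_bilin B C).1 lT mid_linear.
Qed.

Let bil3 : bilinear_map (fun x y : C ⊗ B =>
    tlift (fun c b => tlift (fun c' b' => mid c b' (T (b ⊗ c'))) y) x).
Proof.
split=> [y | x] k u v; first exact: (tlift_linear (bil2 y)).
by apply: tlift_lin_arg => c b; exact: (tlift_linear (bil1 c b)).
Qed.

Lemma mid_map_linear : linear (mid_map T).
Proof. exact: tlift_linear bil3. Qed.

Lemma mid_map_pure c b c' b' :
  mid_map T ((c ⊗ b) ⊗ (c' ⊗ b')) = mid c b' (T (b ⊗ c')).
Proof.
by rewrite /mid_map (tlift_pure _ _ bil3) (tlift_pure _ _ (bil2 _)) tlift_pure.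
Qed.

End MidMap.

Lemma tens_ext_mid (W : lmodType K) (F G : AA -> AA -> W) :
  bilinear_map F -> bilinear_map G ->
  (forall c b c' b' d a d' a', F ((c ⊗ b) ⊗ (c' ⊗ b')) ((d ⊗ a) ⊗ (d' ⊗ a'))
                             = G ((c ⊗ b) ⊗ (c' ⊗ b')) ((d ⊗ a) ⊗ (d' ⊗ a'))) ->
  forall x y, F x y = G x y.
Proof.
move=> bF bG h; apply: tens_ext2 => // p q p' q'; move: p q.
apply: tens_ext2.
- exact: bilin_postcomp (tpure_bilin _ _) (bF.1 _).
- exact: bilin_postcomp (tpure_bilin _ _) (bG.1 _).
move=> c b c' b'; move: p' q'; apply: tens_ext2 => //.
- exact: bilin_postcomp (tpure_bilin _ _) (bF.2 _).
- exact: bilin_postcomp (tpure_bilin _ _) (bG.2 _).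
Qed.

(* The extension to M(B (x) C) of the inclusion B (x) C -> M(A (x) A) that
   comes from B, C \subset M(A), where A = C (x) B. *)
Program Definition mid_mult (m : multiplier (B ⊗ C)) : multiplier AA :=
  @Multiplier _ _ (mid_map (mL m)) (mid_map (mR m)) _ _ _ _ _.
Next Obligation. by move=> m; apply: mid_map_linear; exact: mL_linear. Qed.
Next Obligation. by move=> m; apply: mid_map_linear; exact: mR_linear. Qed.
Next Obligation.
move=> m x y /=.
have lm := mid_map_linear (@mL_linear _ _ m).
move: x y; apply: tens_ext_mid.
- exact: bilin_postcomp (amul_bilin (s := AA)) lm.
- exact: bilin_precomp2 (amul_bilin (s := AA)) lm (id_linear _).
move=> c b c' b' d a d' a'; rewrite !amul_pure.
rewrite !mid_map_pure; try exact: mL_linear.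
by rewrite -mid_pure mid_mul -mL_mul amul_pure.
Qed.
Next Obligation.
move=> m x y /=.
have lm := mid_map_linear (@mR_linear _ _ m).
move: x y; apply: tens_ext_mid.
- exact: bilin_postcomp (amul_bilin (s := AA)) lm.
- exact: bilin_precomp2 (amul_bilin (s := AA)) (id_linear _) lm.
move=> c b c' b' d a d' a'; rewrite !amul_pure.
rewrite !mid_map_pure; try exact: mR_linear.
by rewrite -mid_pure mid_mul -mR_mul amul_pure.
Qed.
Next Obligation.
move=> m x y /=.
have ll := mid_map_linear (@mL_linear _ _ m).
have lr := mid_map_linear (@mR_linear _ _ m).
move: x y; apply: tens_ext_mid.
- exact: bilin_precomp2 (amul_bilin (s := AA)) lr (id_linear _).
- exact: bilin_precomp2 (amul_bilin (s := AA)) (id_linear _) ll.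
move=> c b c' b' d a d' a'.
rewrite !mid_map_pure; try exact: mL_linear; try exact: mR_linear.
by rewrite -!mid_pure !mid_mul mRL.
Qed.

End LegEmbedding.

Section SeparabilityIdempotent.
Variables (K : fieldType) (B C : nuAlgType K).

Record regular_separability_idempotent (E : multiplier (B ⊗ C))
    (SB : B -> C) (SC : C -> B) : Prop := RegularSeparabilityIdempotent {
  rsi_idem : E ** E = E;
  rsi_memC : forall c, exists t, E ** leg2 (mof c) = mof t;
  rsi_memB : forall b, exists t, leg1 (mof b) ** E = mof t;
  rsi_fullB : forall V : B -> Prop, is_subspace V ->
    (forall c, exists2 t, in_tens V (fun=> True) t & E ** leg2 (mof c) = mof t) ->
    forall b, V b;
  rsi_fullC : forall W : C -> Prop, is_subspace W ->
    (forall b, exists2 t, in_tens (fun=> True) W t & leg1 (mof b) ** E = mof t) ->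
    forall c, W c;
  rsi_antiB : anti_isomorphism SB;
  rsi_antiC : anti_isomorphism SC;
  rsi_SB : forall b, E ** leg1 (mof b) = E ** leg2 (mof (SB b));
  rsi_SC : forall c, leg2 (mof c) ** E = leg1 (mof (SC c)) ** E
}.

(* (phiB (x) id)(E (1 (x) c)) = c and (id (x) phiC)((b (x) 1) E) = b; the
   element t below exists by rsi_memC, resp. rsi_memB. *)
Definition is_phiB (E : multiplier (B ⊗ C)) (phiB : {scalar B}) :=
  forall c t, E ** leg2 (mof c) = mof t -> tlift (fun b c' => phiB b *: c') t = c.

Definition is_phiC (E : multiplier (B ⊗ C)) (phiC : {scalar C}) :=
  forall b t, leg1 (mof b) ** E = mof t -> tlift (fun b' c => phiC c *: b') t = b.

(* Delta(cb) = (c (x) 1) E (1 (x) b): c acts on the first factor of C (x) B (x)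
   C (x) B, E on the two middle ones, b on the last. *)
Definition coproduct (E : multiplier (B ⊗ C)) :
    C ⊗ B -> multiplier ((C ⊗ B) ⊗ (C ⊗ B)) :=
  tlift (fun c b =>
    leg1 (leg1 (mof c)) ** mid_mult E ** leg2 (leg2 (mof b))).

Variables (SB : B -> C) (SC : C -> B) (phiB : {scalar B}) (phiC : {scalar C}).

(* In C (x) B, the pure tensor of c and b is the element cb = bc of A. *)
Definition counit : C ⊗ B -> K :=
  tlift (W := K^o) (fun c b => phiB (SC c ** b)).

Definition phiA : C ⊗ B -> K :=
  tlift (W := K^o) (fun c b => phiC c * phiB b).

Definition diamond (u : B) (v : C) : C ⊗ B -> K :=
  tlift (W := K^o) (fun c b => phiB (b ** SC v) * phiC (SB u ** c)).

End SeparabilityIdempotent.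

Section Dual.
Variables (K : fieldType) (A : nuAlgType K) (phi : A -> K).
Variable Delta : A -> multiplier (A ⊗ A).

Definition represents (p : A) (w : A -> K) := forall a, w a = phi (a ** p).

Definition in_dual (w : A -> K) := exists p, represents p w.

(* An element p with w = phi( . p), unique when phi is faithful.  The default
   value 0 outside in_dual is never reached on the functionals u diamond v, by
   lemma diamond_in_dual. *)
Definition representative (w : A -> K) : A := xget 0 [set p | represents p w].

(* (w (x) w')(m) = (phi (x) phi)(m (p (x) q)) for w = phi( . p), w' = phi( . q) *)
Definition pair_at (p q : A) (m : multiplier (A ⊗ A)) : K :=
  tlift (W := K^o) (fun a a' => phi a * phi a') (mL m (p ⊗ q)).

(* (w w')(a) = (w (x) w')(Delta a) *)
Definition dual_mul (w w' : A -> K) : A -> K :=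
  fun a => pair_at (representative w) (representative w') (Delta a).

End Dual.

Section DiamondInDual.
Variables (K : fieldType) (B C : nuAlgType K).
Hypotheses (ndB : nondegenerate_algebra B) (idC : idempotent_algebra C).
Variables (E : multiplier (B ⊗ C)) (SB : B -> C) (SC : C -> B).
Hypothesis hE : regular_separability_idempotent E SB SC.
Variables (phiB : {scalar B}) (phiC : {scalar C}).
Hypothesis hC : is_phiC E phiC.

Lemma mul_mof (A : nuAlgType K) (m : multiplier A) t : m ** mof t = mof (mL m t).
Proof. by apply: multiplier_ext => x /=; rewrite ?mL_mul ?mRL. Qed.

Lemma mof_mul (A : nuAlgType K) (m : multiplier A) t : mof t ** m = mof (mR m t).
Proof. by apply: multiplier_ext => x /=; rewrite ?mR_mul ?mRL. Qed.

Lemma mL_tens (A A' : nuAlgType K) (m : multiplier A) (n : multiplier A') a b :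
  mL (mtens m n) (a ⊗ b) = mL m a ⊗ mL n b.
Proof. by apply: tmapL_pure; exact: mL_linear. Qed.

Lemma mR_tens (A A' : nuAlgType K) (m : multiplier A) (n : multiplier A') a b :
  mR (mtens m n) (a ⊗ b) = mR m a ⊗ mR n b.
Proof. by apply: tmapL_pure; exact: mR_linear. Qed.

Lemma mL_mulE (A : nuAlgType K) (m n : multiplier A) x :
  mL (m ** n) x = mL m (mL n x).
Proof. by []. Qed.

Lemma mR_mulE (A : nuAlgType K) (m n : multiplier A) x :
  mR (m ** n) x = mR n (mR m x).
Proof. by []. Qed.

Lemma leg1M (A A' : nuAlgType K) (m n : multiplier A) :
  leg1 (m ** n) = leg1 m ** leg1 n :> multiplier (A ⊗ A').
Proof.
apply: multiplier_ext; apply: tens_ext.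
- exact: @mL_linear _ _ (leg1 (m ** n)).
- exact: @mL_linear _ _ (leg1 m ** leg1 n).
- by move=> a a'; rewrite /leg1 ?/leg2 ?mL_mulE !mL_tens.
- exact: @mR_linear _ _ (leg1 (m ** n)).
- exact: @mR_linear _ _ (leg1 m ** leg1 n).
- by move=> a a'; rewrite /leg1 ?/leg2 ?mR_mulE !mR_tens.
Qed.

Lemma mof_amul (A : nuAlgType K) (x y : A) : mof (x ** y) = mof x ** mof y.
Proof. by rewrite mul_mof. Qed.

Lemma leg12C (A A' : nuAlgType K) (m : multiplier A) (n : multiplier A') :
  leg1 m ** leg2 n = leg2 n ** leg1 m.
Proof.
apply: multiplier_ext; apply: tens_ext.
- exact: @mL_linear _ _ (leg1 m ** leg2 n).
- exact: @mL_linear _ _ (leg2 n ** leg1 m).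
- by move=> a a'; rewrite /leg1 ?/leg2 ?mL_mulE !mL_tens.
- exact: @mR_linear _ _ (leg1 m ** leg2 n).
- exact: @mR_linear _ _ (leg2 n ** leg1 m).
- by move=> a a'; rewrite /leg1 ?/leg2 ?mR_mulE !mR_tens.
Qed.

Definition slice (f : C -> K) (t : B ⊗ C) : B := tlift (fun b c => f c *: b) t.

Lemma slice_bilin (f : C -> K) : linear (f : C -> K^o) -> bilinear_map (fun (b : B) c => f c *: b).
Proof.
move=> lf; split=> [c | b] k x y.
  by rewrite scalerDr !scalerA mulrC.
by rewrite lf scalerDl scalerA.
Qed.

Lemma slice_linear (f : C -> K) : linear (f : C -> K^o) -> linear (slice f).
Proof. by move=> lf; apply: tlift_linear; exact: slice_bilin. Qed.

Lemma slice_pure (f : C -> K) b c : linear (f : C -> K^o) -> slice f (b ⊗ c) = f c *: b.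
Proof. by move=> lf; apply: tlift_pure; exact: slice_bilin. Qed.

Lemma linphiC : linear (phiC : C -> K^o). Proof. exact: linearP. Qed.

Lemma right_leg_eq (f g : C -> K) : linear (f : C -> K^o) -> linear (g : C -> K^o) ->
  (forall b t, leg1 (mof b) ** E = mof t -> slice f t = slice g t) -> f =1 g.
Proof.
move=> lf lg h; set d := fun c => f c - g c.
have ld : linear (d : C -> K^o).
  by move=> k x y; rewrite /d lf lg scalerBr opprD addrACA.
suff d0 c : d c = 0 by move=> c; apply/eqP; rewrite -subr_eq0; apply/eqP/d0.
apply: contrapT => /eqP dc; pose c0 := (d c)^-1 *: c.
have dc0 : d c0 = 1 by rewrite /c0 (linZ ld) /GRing.scale /= mulVf.
suff : d c0 = 0 by move/eqP; rewrite dc0 oner_eq0.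
apply: (rsi_fullC hE (W := fun c => d c = 0)).
  split=> [|k x y dx dy]; first exact: (lin0 ld).
  by rewrite ld dx dy scaler0 addr0.
move=> b; have [t ht] := rsi_memB hE b; exists t => //.
have dt : slice d t = 0.
  transitivity (slice f t - slice g t); last by rewrite (h b t ht) subrr.
  rewrite addrC -scaleN1r; apply: tlift_lin_arg => b' c'.
  by rewrite /d scalerBl scaleN1r addrC.
exists [seq (x.1, x.2 - d x.2 *: c0) | x <- repr t].
  move=> _ /mapP[x _ ->]; split=> //=.
  by rewrite (linB ld) (linZ ld) dc0 /GRing.scale /= mulr1 subrr.
rewrite big_map {1}[t]tens_sum /= -[LHS]subr0.
rewrite -[X in _ - X](lin0 ((tpure_bilin B C).1 c0)) -dt [t in slice _ t]tens_sum.
rewrite (lin_sum _ _ (slice_linear ld)) (lin_sum _ _ ((tpure_bilin B C).1 c0)).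
rewrite -sumrB; apply: eq_bigr => x _.
rewrite (slice_pure _ _ ld) (linB ((tpure_bilin B C).2 x.1)).
by rewrite (linZ ((tpure_bilin B C).2 x.1)) (linZ ((tpure_bilin B C).1 c0)).
Qed.

Lemma lin_amul (f : C -> K^o) (y z : C) : linear f -> linear (fun x => f (y ** x ** z)).
Proof. by move=> lf k u v; rewrite amul_linr amul_linl lf. Qed.
Lemma lin_amulL (f : C -> K^o) (y : C) : linear f -> linear (fun x => f (y ** x)).
Proof. by move=> lf k u v; rewrite amul_linr lf. Qed.

Lemma slice_phiC_mulL b t c : leg1 (mof b) ** E = mof t ->
  slice (fun y => phiC (c ** y)) t = b ** SC c.
Proof.
move=> ht; rewrite -(@hC (b ** SC c) (mL (leg2 (mof c)) t)); last first.
  rewrite -mul_mof -ht amulA -leg12C -amulA (rsi_SC hE) amulA.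
  by rewrite mof_amul leg1M.
move: t {ht}; apply: tens_ext.
- exact: slice_linear (lin_amulL _ linphiC).
- exact: lin_comp (slice_linear linphiC) (@mL_linear _ _ (leg2 (mof c))).
move=> b' c'; rewrite (slice_pure _ _ (lin_amulL _ linphiC)).
by rewrite -/(slice phiC _) mL_tens (slice_pure _ _ linphiC).
Qed.

Lemma slice_phiC_mulLR b t y b' : leg1 (mof b) ** E = mof t ->
  slice (fun z => phiC (y ** z ** SB b')) t = b ** SC y ** b'.
Proof.
move=> ht; apply/eqP; rewrite -subr_eq0; apply/eqP; apply: ndB.2 => x.
rewrite (linB (amul_linr x)) -(slice_phiC_mulL y ht).
have e : mof (mR (leg2 (mof (SB b'))) t) = mof (mR (leg1 (mof b')) t).
  by rewrite -!mof_mul -ht -!amulA (rsi_SB hE).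
have {}e : slice phiC ((x ⊗ y) ** mR (leg2 (mof (SB b'))) t)
         = slice phiC ((x ⊗ y) ** mR (leg1 (mof b')) t).
  by congr slice; have := congr1 (fun m => mR m (x ⊗ y)) e.
have lmul : linear (fun s : B ⊗ C => (x ⊗ y) ** s) by exact: amul_linr.
apply/eqP; rewrite subr_eq0; apply/eqP.
transitivity (slice phiC ((x ⊗ y) ** mR (leg2 (mof (SB b'))) t)).
  move: t {e ht}; apply: tens_ext.
  - exact: lin_comp (amul_linr _) (slice_linear (lin_amul _ _ linphiC)).
  - apply: lin_comp (slice_linear linphiC) _.
    exact: lin_comp lmul (@mR_linear _ _ (leg2 _)).
  move=> p q; rewrite (slice_pure _ _ (lin_amul _ _ linphiC)) mR_tens.
  by rewrite amul_pure (slice_pure _ _ linphiC) amulA (linZ (amul_linr x)).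
rewrite e; move: t {e ht}; apply: tens_ext.
- apply: lin_comp (slice_linear linphiC) _.
  exact: lin_comp lmul (@mR_linear _ _ (leg1 _)).
- apply: lin_comp (amul_linr _) _.
  exact: lin_comp (amul_linl b') (slice_linear (lin_amulL _ linphiC)).
move=> p q; rewrite (slice_pure _ _ (lin_amulL _ linphiC)) mR_tens.
rewrite amul_pure (slice_pure _ _ linphiC) (linZ (amul_linl b')).
by rewrite (linZ (amul_linr x)).
Qed.

(* phiC (c c') = phiC (c' sigma_C(c)) with sigma_C = SB SC. *)
Lemma phiC_modular c w : phiC (c ** w) = phiC (w ** SB (SC c)).
Proof.
have [s ->] := idC w.
rewrite (lin_sum _ _ (amul_linr c)) (lin_sum _ _ (amul_linl (SB (SC c)))).
rewrite !(lin_sum _ _ linphiC); apply: eq_bigr => -[y z] _ /=; rewrite amulA.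
apply: (right_leg_eq (lin_amulL (c ** y) linphiC) (lin_amul y (SB (SC c)) linphiC)).
move=> b t ht; rewrite (slice_phiC_mulL _ ht) (slice_phiC_mulLR _ _ ht).
by have [_ _ ->] := rsi_antiC hE; rewrite amulA.
Qed.

Lemma prod_bilin (X Y : lmodType K) (f : X -> K^o) (g : Y -> K^o) :
  linear f -> linear g -> bilinear_map (fun x y => f x * g y : K^o).
Proof.
move=> lf lg; split=> [y | x] k u v.
  by rewrite lf mulrDl -scalerAl.
by rewrite lg mulrDr -scalerAr.
Qed.

Lemma diamond_in_dual u v :
  in_dual (phiA phiB phiC) (diamond SB SC phiB phiC u v).
Proof.
have lB : linear (phiB : B -> K^o) by exact: linearP.
exists (SB (SC (SB u)) ⊗ SC v).
have l1 : linear (fun c => phiC (SB u ** c) : K^o) := lin_amulL _ linphiC.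
have l2 : linear (fun b => phiB (b ** SC v) : K^o).
  exact: lin_comp lB (amul_linl _).
have bd : bilinear_map (fun c b => phiB (b ** SC v) * phiC (SB u ** c) : K^o).
  have [d1 d2] := prod_bilin l2 l1.
  by split=> *; [exact: d2 | exact: d1].
have bp := prod_bilin linphiC lB.
apply: (@tens_ext _ _ _ K^o).
- exact: tlift_linear bd.
- apply: lin_comp (tlift_linear bp) _; exact: amul_linl.
move=> c b; rewrite amul_pure /diamond /phiA !tlift_pure //.
by rewrite phiC_modular mulrC.
Qed.

End DiamondInDual.

(* Main.v *)
(* Write E(1 (x) c) and (b (x) 1)E in B (x) C and slice them with phiB and phiC.
   Computing (phiB (x) phiC)((b (x) 1)E(1 (x) c)) in both orders gives
   phiC(c S_B(b)) = phiB(S_C(c) b), whence, by modularity of phiC,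
   phiC(S_B(b) S_B(y)) = phiB(y b).  Since (phiB (x) phiC)(E(b (x) c)) =
   phiC(S_B(b) c), the pairing of Delta(cb) with c1 b1 (x) c2 b2 is
   phiC(c c1) phiC(S_B(b1) c2) phiB(b b2).  The two identities turn its middle
   factor into a value of phi( . p), and then of phi( . q), so that the pairing
   depends on p and q only through the functionals they represent. *)
Require Import Defs.
From mathcomp Require Import all_boot all_order all_algebra.
From mathcomp Require Import boolp classical_sets reals complex.

Import GRing.Theory.
Local Open Scope ring_scope.

Section SeparabilityFunctionals.
Set Implicit Arguments.
Unset Strict Implicit.
Context {K : fieldType} {B C : nuAlgType K}.
Context (ndB : nondegenerate_algebra B) (idB : idempotent_algebra B).
Context (ndC : nondegenerate_algebra C) (idC : idempotent_algebra C).
Context {E : multiplier (B ⊗ C)} {SB : B -> C} {SC : C -> B}.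
Context (hE : regular_separability_idempotent E SB SC).
Context {phiB : {scalar B}} {phiC : {scalar C}}.
Context (hB : is_phiB E phiB) (hC : is_phiC E phiC).

(** * Multipliers acting on one tensor factor *)

Lemma leg2M (A A' : nuAlgType K) (m n : multiplier A') :
  leg2 (m ** n) = leg2 m ** leg2 n :> multiplier (A ⊗ A').
Proof.
apply: multiplier_ext; apply: tens_ext.
- exact: @mL_linear _ _ (leg2 (m ** n)).
- exact: @mL_linear _ _ (leg2 m ** leg2 n).
- by move=> a a'; rewrite /leg2 mL_mulE !mL_tens.
- exact: @mR_linear _ _ (leg2 (m ** n)).
- exact: @mR_linear _ _ (leg2 m ** leg2 n).
- by move=> a a'; rewrite /leg2 mR_mulE !mR_tens.
Qed.

Lemma mof_pure (A A' : nuAlgType K) (a : A) (a' : A') :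
  mof (a ⊗ a') = leg1 (mof a) ** leg2 (mof a').
Proof.
apply: multiplier_ext; apply: tens_ext.
- exact: @mL_linear _ _ (mof (a ⊗ a')).
- exact: @mL_linear _ _ (leg1 (mof a) ** leg2 (mof a')).
- by move=> x y; rewrite mL_mulE !mL_tens /= amul_pure.
- exact: @mR_linear _ _ (mof (a ⊗ a')).
- exact: @mR_linear _ _ (leg1 (mof a) ** leg2 (mof a')).
- by move=> x y; rewrite mR_mulE !mR_tens /= amul_pure.
Qed.

Lemma linZr (V : lmodType K) (k : K) : linear (fun x : V => k *: x).
Proof. by move=> a x y; rewrite scalerDr !scalerA mulrC. Qed.

(** * Slices of [E] by [phiB] *)

Lemma linphiB : linear (phiB : B -> K^o). Proof. exact: linearP. Qed.

Definition lslice (f : B -> K) (t : B ⊗ C) : C := tlift (fun b c => f b *: c) t.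

Lemma lslice_bilin (f : B -> K) :
  linear (f : B -> K^o) -> bilinear_map (fun b (c : C) => f b *: c).
Proof.
move=> lf; split=> [c | b] k x y.
  by rewrite lf scalerDl scalerA.
by rewrite scalerDr !scalerA mulrC.
Qed.

Lemma lslice_linear (f : B -> K) : linear (f : B -> K^o) -> linear (lslice f).
Proof. by move=> lf; apply: tlift_linear; exact: lslice_bilin. Qed.

Lemma lslice_pure (f : B -> K) b c :
  linear (f : B -> K^o) -> lslice f (b ⊗ c) = f b *: c.
Proof. by move=> lf; apply: tlift_pure; exact: lslice_bilin. Qed.

Lemma linphiB_mulR b : linear (fun x => phiB (x ** b) : K^o).
Proof. exact: lin_comp linphiB (amul_linl b). Qed.

Lemma linphiB_mulLR b b' : linear (fun x => phiB (b ** x ** b') : K^o).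
Proof. exact: lin_comp (linphiB_mulR b') (amul_linr b). Qed.

Lemma linphiC_mulR c : linear (fun x => phiC (x ** c) : K^o).
Proof. exact: lin_comp (linphiC phiC) (amul_linl c). Qed.

(** By [rsi_SB], E(1 ⊗ c)(b ⊗ 1) = E(1 ⊗ S_B(b)c), so [t] times b ⊗ 1 is an element to which the
    defining property of [phiB] applies. *)
Lemma lslice_phiB_mulR b t c : E ** leg2 (mof c) = mof t ->
  lslice (fun z => phiB (z ** b)) t = SB b ** c.
Proof.
move=> ht; rewrite -(@hB (SB b ** c) (mR (leg1 (mof b)) t)); last first.
  by rewrite -mof_mul -ht -amulA -leg12C amulA (rsi_SB hE) -amulA mof_amul leg2M.
move: t {ht}; apply: tens_ext.
- exact: lslice_linear (linphiB_mulR b).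
- exact: lin_comp (lslice_linear linphiB) (@mR_linear _ _ (leg1 _)).
move=> p q; rewrite (lslice_pure _ _ (linphiB_mulR b)).
by rewrite -/(lslice phiB _) mR_tens (lslice_pure _ _ linphiB).
Qed.

(* [mof] is not known to be injective on [B ⊗ C], so equal multipliers are
   compared after multiplication by a pure tensor. *)
Lemma mof_mulr_eq (s t : B ⊗ C) x : mof s = mof t -> s ** x = t ** x.
Proof. by move=> /(congr1 (fun m => mL m x)). Qed.

(** The factor S_C(d) on the left of the first leg equals [d] on the left of the second leg, by
    [rsi_SC]; what remains is [lslice_phiB_mulR]. *)
Lemma lslice_phiB_mulLR b t c d : E ** leg2 (mof c) = mof t ->
  lslice (fun z => phiB (SC d ** z ** b)) t = d ** SB b ** c.
Proof.
(* Non-degeneracy of [C] reduces the claim to its right multiples by [y]. Both sides then come from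
   products with [b ⊗ y], for which the equality [e] of multipliers suffices. *)
move=> ht; apply/eqP; rewrite -subr_eq0; apply/eqP; apply: ndC.1 => y.
rewrite (linB (amul_linl y)) -[d ** _ ** _]amulA -(lslice_phiB_mulR b ht).
apply/eqP; rewrite subr_eq0; apply/eqP.
have e : mof (mL (leg1 (mof (SC d))) t) = mof (mL (leg2 (mof d)) t).
  by rewrite -!mul_mof -ht !amulA (rsi_SC hE).
transitivity (lslice phiB (mL (leg1 (mof (SC d))) t ** (b ⊗ y))).
  move: t {e ht}; apply: tens_ext.
  - exact: lin_comp (amul_linl _) (lslice_linear (linphiB_mulLR _ _)).
  - apply: lin_comp (lslice_linear linphiB) _.
    exact: lin_comp (amul_linl (b ⊗ y)) (@mL_linear _ _ (leg1 _)).
  move=> p q; rewrite (lslice_pure _ _ (linphiB_mulLR _ _)) mL_tens.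
  by rewrite amul_pure (lslice_pure _ _ linphiB) (linZ (amul_linl y)).
rewrite (mof_mulr_eq _ e); move: t {e ht}; apply: tens_ext.
- apply: lin_comp (lslice_linear linphiB) _.
  exact: lin_comp (amul_linl (b ⊗ y)) (@mL_linear _ _ (leg2 _)).
- apply: lin_comp (amul_linl y) _.
  exact: lin_comp (amul_linr d) (lslice_linear (linphiB_mulR _)).
move=> p q; rewrite (lslice_pure _ _ (linphiB_mulR _)) mL_tens.
rewrite amul_pure (lslice_pure _ _ linphiB) (linZ (amul_linr d)).
by rewrite (linZ (amul_linl y)).
Qed.

(** * Exchange between [phiB] and [phiC] *)

Lemma SBM x y : SB (x ** y) = SB y ** SB x.
Proof. by have [_ _] := rsi_antiB hE. Qed.

Lemma SB_linear : linear SB. Proof. by have [] := rsi_antiB hE. Qed.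

Lemma SB_surj c : exists b, SB b = c.
Proof. by have [_ [g _ gK] _] := rsi_antiB hE; exists (g c). Qed.

Lemma SC_surj b : exists c, SC c = b.
Proof. by have [_ [g _ gK] _] := rsi_antiC hE; exists (g b). Qed.

Lemma phiC_modularE c w : phiC (c ** w) = phiC (w ** SB (SC c)).
Proof. exact: (phiC_modular ndB idC hE hC). Qed.

(** For b' = S_C(c), modularity of [phiC] moves S_B(S_C(c)) to the left as [c], where
    [slice_phiC_mulL] applies. *)
Lemma slice_phiC_mulR b t b' : leg1 (mof b) ** E = mof t ->
  slice (fun z => phiC (z ** SB b')) t = b ** b'.
Proof.
have [c <-] := SC_surj b' => ht; rewrite -(slice_phiC_mulL hE hC c ht).
by congr slice; apply/funext => z; rewrite -phiC_modularE.
Qed.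

Lemma prod_phi_bilin : bilinear_map (fun b c => phiB b * phiC c : K^o).
Proof. exact: prod_bilin linphiB (linphiC phiC). Qed.

Definition prod_phi : B ⊗ C -> K^o :=
  tlift (W := K^o) (fun b c => phiB b * phiC c).

Lemma prod_phi_linear : linear prod_phi.
Proof. exact: tlift_linear prod_phi_bilin. Qed.

Lemma prod_phi_pure b c : prod_phi (b ⊗ c) = phiB b * phiC c.
Proof. exact: tlift_pure prod_phi_bilin. Qed.

Lemma prod_phi_lslice t : prod_phi t = phiC (lslice phiB t).
Proof.
move: t; apply: (@tens_ext _ _ _ K^o).
- exact: prod_phi_linear.
- exact: lin_comp (linphiC phiC) (lslice_linear linphiB).
move=> b c; rewrite prod_phi_pure (lslice_pure _ _ linphiB).
by rewrite (linZ (linphiC phiC)).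
Qed.

(* The two sides are the values of [prod_phi] on
   (S_C(c) (x) 1) E (1 (x) S_B(b2)) (b3 (x) S_B(b1)). *)
Lemma phi_exchange_mul c b1 b2 b3 :
  phiC (c ** SB (b1 ** b2 ** b3)) = phiB (SC c ** (b1 ** b2 ** b3)).
Proof.
have [t ht] := rsi_memB hE (SC c); have [s hs] := rsi_memC hE (SB b2).
have e : mof (mL (leg1 (mof (SC c))) s) = mof (mR (leg2 (mof (SB b2))) t).
  by rewrite -mul_mof -mof_mul -hs -ht amulA.
transitivity (prod_phi (mL (leg1 (mof (SC c))) s ** (b3 ⊗ SB b1))).
  rewrite !SBM !amulA -(lslice_phiB_mulLR b3 c hs).
  move: s {hs e}; apply: (@tens_ext _ _ _ K^o).
  - exact: lin_comp (linphiC_mulR _) (lslice_linear (linphiB_mulLR _ _)).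
  - apply: lin_comp prod_phi_linear _.
    exact: lin_comp (amul_linl _) (@mL_linear _ _ (leg1 _)).
  move=> p q; rewrite (lslice_pure _ _ (linphiB_mulLR _ _)) mL_tens.
  by rewrite amul_pure prod_phi_pure (linZ (linphiC_mulR _)).
rewrite (mof_mulr_eq _ e) amulA -(slice_phiC_mulR (b1 ** b2) ht).
move: t {ht e}; apply: (@tens_ext _ _ _ K^o).
- apply: lin_comp prod_phi_linear _.
  exact: lin_comp (amul_linl _) (@mR_linear _ _ (leg2 _)).
- exact: lin_comp (linphiB_mulR _) (slice_linear (linphiC_mulR _)).
move=> p q; rewrite (slice_pure _ _ (linphiC_mulR _)) mR_tens.
by rewrite amul_pure prod_phi_pure (linZ (linphiB_mulR _)) SBM amulA mulrC.
Qed.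

(** Both sides are linear in [b], and idempotence of [B], used twice, makes [b] a sum of triple
    products. The middle factor brings E into B ⊗ C, the outer two supply the test tensor. *)
Lemma phi_exchange c b : phiC (c ** SB b) = phiB (SC c ** b).
Proof.
have lL : linear (fun b => phiC (c ** SB b) : K^o).
  exact: lin_comp (linphiC phiC) (lin_comp (amul_linr c) SB_linear).
have lR : linear (fun b => phiB (SC c ** b) : K^o).
  exact: lin_comp linphiB (amul_linr _).
have [s ->] := idB b; rewrite (lin_sum _ _ lL) (lin_sum _ _ lR).
apply: eq_bigr => -[x y] _ /=; have [r ->] := idB x.
rewrite (lin_sum _ _ (amul_linl y)) (lin_sum _ _ lL) (lin_sum _ _ lR).
by apply: eq_bigr => z _; exact: phi_exchange_mul.
Qed.

Lemma phiC_SB_mul b y : phiC (SB b ** SB y) = phiB (y ** b).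
Proof. by have [c <-] := SC_surj y; rewrite -phiC_modularE phi_exchange. Qed.

(** As multipliers, E(b ⊗ c) = E(1 ⊗ S_B(b)c), whose slice by [phiB] is S_B(b)c. *)
Lemma prod_phi_E b c : prod_phi (mL E (b ⊗ c)) = phiC (SB b ** c).
Proof.
rewrite prod_phi_lslice; congr (phiC _); apply: hB.
by rewrite -mul_mof mof_pure amulA (rsi_SB hE) mof_amul leg2M amulA.
Qed.

(** * Pairing of the coproduct with elements of A ⊗ A *)

Let AA := ((C ⊗ B) ⊗ (C ⊗ B))%type.

Lemma phiA_bilin : bilinear_map (fun c b => phiC c * phiB b : K^o).
Proof. exact: prod_bilin (linphiC phiC) linphiB. Qed.

Lemma phiA_linear : linear (phiA phiB phiC : C ⊗ B -> K^o).
Proof. exact: tlift_linear phiA_bilin. Qed.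

Lemma phiA_pure c b : phiA phiB phiC (c ⊗ b) = phiC c * phiB b.
Proof. exact: tlift_pure phiA_bilin. Qed.

Definition phiAA : AA -> K^o :=
  tlift (W := K^o) (fun x y => phiA phiB phiC x * phiA phiB phiC y).

Lemma phiAA_linear : linear phiAA.
Proof. exact: tlift_linear (prod_bilin phiA_linear phiA_linear). Qed.

Lemma phiAA_pure x y : phiAA (x ⊗ y) = phiA phiB phiC x * phiA phiB phiC y.
Proof. exact: tlift_pure (prod_bilin phiA_linear phiA_linear). Qed.

Lemma phiAA_mid c b t : phiAA (mid c b t) = phiC c * phiB b * prod_phi t.
Proof.
move: t; apply: (@tens_ext _ _ _ K^o).
- exact: lin_comp phiAA_linear (mid_linear c b).
- exact: lin_comp (linZr _) prod_phi_linear.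
move=> b' c'; rewrite mid_pure phiAA_pure !phiA_pure prod_phi_pure.
by rewrite [phiC c' * _]mulrC [RHS]mulrACA.
Qed.

Lemma mof_linear (A : nuAlgType K) : linear (@mof K A).
Proof.
move=> k x y; apply: multiplier_ext => z /=; first exact: amul_linl.
exact: amul_linr.
Qed.

Lemma mL_scaleD (A : nuAlgType K) k (m n : multiplier A) x :
  mL (k *: m + n) x = k *: mL m x + mL n x.
Proof. by []. Qed.

Lemma mR_scaleD (A : nuAlgType K) k (m n : multiplier A) x :
  mR (k *: m + n) x = k *: mR m x + mR n x.
Proof. by []. Qed.

Lemma leg1_linear (A A' : nuAlgType K) : linear (@leg1 K A A').
Proof.
move=> k m n; apply: multiplier_ext; apply: tens_ext.
- exact: @mL_linear _ _ (leg1 (k *: m + n)).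
- exact: @mL_linear _ _ (k *: leg1 m + leg1 n).
- by move=> x y; rewrite mL_scaleD !mL_tens mL_scaleD (tpure_bilin _ _).1.
- exact: @mR_linear _ _ (leg1 (k *: m + n)).
- exact: @mR_linear _ _ (k *: leg1 m + leg1 n).
by move=> x y; rewrite mR_scaleD !mR_tens mR_scaleD (tpure_bilin _ _).1.
Qed.

Lemma leg2_linear (A A' : nuAlgType K) : linear (@leg2 K A A').
Proof.
move=> k m n; apply: multiplier_ext; apply: tens_ext.
- exact: @mL_linear _ _ (leg2 (k *: m + n)).
- exact: @mL_linear _ _ (k *: leg2 m + leg2 n).
- by move=> x y; rewrite mL_scaleD !mL_tens mL_scaleD (tpure_bilin _ _).2.
- exact: @mR_linear _ _ (leg2 (k *: m + n)).
- exact: @mR_linear _ _ (k *: leg2 m + leg2 n).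
by move=> x y; rewrite mR_scaleD !mR_tens mR_scaleD (tpure_bilin _ _).2.
Qed.

Lemma coproduct_bilin : bilinear_map (fun c b =>
  leg1 (leg1 (mof c)) ** mid_mult E ** leg2 (leg2 (mof b)) : multiplier AA).
Proof.
split=> [b | c] k x y.
  by rewrite mof_linear !leg1_linear !amul_linl.
by rewrite mof_linear !leg2_linear amul_linr.
Qed.

Lemma coproduct_pure c b : coproduct E (c ⊗ b) =
  leg1 (leg1 (mof c)) ** mid_mult E ** leg2 (leg2 (mof b)).
Proof. exact: tlift_pure coproduct_bilin. Qed.

Lemma mL_mid_mult (m : multiplier (B ⊗ C)) c b c' b' :
  mL (mid_mult m) ((c ⊗ b) ⊗ (c' ⊗ b')) = mid c b' (mL m (b ⊗ c')).
Proof. by apply: mid_map_pure; exact: mL_linear. Qed.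

Lemma pair_at_coproduct_pure c b c1 b1 c2 b2 :
  pair_at (phiA phiB phiC) (c1 ⊗ b1) (c2 ⊗ b2) (coproduct E (c ⊗ b))
  = phiC (c ** c1) * phiB (b ** b2) * phiC (SB b1 ** c2).
Proof.
rewrite /pair_at -/phiAA coproduct_pure !mL_mulE !mL_tens mL_mid_mult.
rewrite -prod_phi_E -phiAA_mid; congr phiAA.
(* Left multiplication by [c] touches only the outer first factor, so E(b1 ⊗ c2) may be replaced by
   any element of B ⊗ C, and by linearity by a pure tensor. *)
move: (mL E _); apply: tens_ext.
- exact: lin_comp (@mL_linear _ _ (leg1 (leg1 (mof c)))) (mid_linear _ _).
- exact: mid_linear.
by move=> x y; rewrite !mid_pure !mL_tens.
Qed.

Lemma pair_at_linear (p q : C ⊗ B) :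
  linear (pair_at (phiA phiB phiC) p q : multiplier AA -> K^o).
Proof. by move=> k m n; exact: phiAA_linear. Qed.

Lemma pair_at_bilin (m : multiplier AA) :
  bilinear_map (fun p q => pair_at (phiA phiB phiC) p q m : K^o).
Proof.
have [t1 t2] := tpure_bilin (C ⊗ B)%type (C ⊗ B)%type.
by split=> [q | p] k x y; rewrite /pair_at -/phiAA ?t1 ?t2 mL_linear phiAA_linear.
Qed.

(** * The product of two diamond functionals *)

Lemma diamond_bilin u v :
  bilinear_map (fun c b => phiB (b ** SC v) * phiC (SB u ** c) : K^o).
Proof.
have [d1 d2] := prod_bilin (linphiB_mulR (SC v)) (lin_amulL (SB u) (linphiC phiC)).
by split=> *; [exact: d2 | exact: d1].
Qed.

Lemma diamond_pure u v c b :
  diamond SB SC phiB phiC u v (c ⊗ b) = phiB (b ** SC v) * phiC (SB u ** c).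
Proof. exact: tlift_pure (diamond_bilin u v). Qed.

Lemma counit_pure c b : counit SC phiB (c ⊗ b) = phiB (SC c ** b).
Proof.
apply: (@tlift_pure _ _ _ K^o); split=> [b' | c'] k x y; last first.
  by rewrite amul_linr linphiB.
by have [-> _ _] := rsi_antiC hE; rewrite amul_linl linphiB.
Qed.

(** With c2 = S_B(y), the factor phiC(S_B(b1)c2) becomes phiB(y b1). The terms in [p] then assemble
    into the first functional evaluated at c ⊗ y. *)
Lemma pair_at_represents p u v c b c2 b2 :
  represents (phiA phiB phiC) p (diamond SB SC phiB phiC u v) ->
  pair_at (phiA phiB phiC) p (c2 ⊗ b2) (coproduct E (c ⊗ b))
  = phiC (SB u ** c) * phiA phiB phiC ((SB (SC v) ⊗ b) ** (c2 ⊗ b2)).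
Proof.
have [y <-] := SB_surj c2 => hp.
transitivity (phiB (b ** b2) * diamond SB SC phiB phiC u v (c ⊗ y)).
  rewrite hp; move: p {hp}; apply: (@tens_ext _ _ _ K^o).
  - exact: (pair_at_bilin _).1.
  - exact: lin_comp (linZr _) (lin_comp phiA_linear (amul_linr _)).
  move=> c1 b1; rewrite pair_at_coproduct_pure phiC_SB_mul amul_pure phiA_pure.
  by rewrite mulrAC mulrC.
(* The same identity read backwards turns phiB(y S_C(v)) into phiC(S_B(S_C(v))c2): [y] disappears
   and a value of φ( . q) at q = c2 ⊗ b2 appears. *)
rewrite diamond_pure -[phiB (y ** _)]phiC_SB_mul amul_pure phiA_pure.
by rewrite mulrC mulrAC mulrC.
Qed.

Lemma pair_at_represents2 p q u v u' v' :
  represents (phiA phiB phiC) p (diamond SB SC phiB phiC u v) ->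
  represents (phiA phiB phiC) q (diamond SB SC phiB phiC u' v') ->
  forall a, pair_at (phiA phiB phiC) p q (coproduct E a)
  = counit SC phiB (v ⊗ u') * diamond SB SC phiB phiC u v' a.
Proof.
move=> hp hq; apply: (@tens_ext _ _ _ K^o).
- exact: lin_comp (pair_at_linear p q) (tlift_linear coproduct_bilin).
- exact: lin_comp (linZr _) (tlift_linear (diamond_bilin u v')).
move=> c b.
transitivity (phiC (SB u ** c) * diamond SB SC phiB phiC u' v' (SB (SC v) ⊗ b)).
  rewrite hq; move: q {hq}; apply: (@tens_ext _ _ _ K^o).
  - exact: (pair_at_bilin _).2.
  - exact: lin_comp (linZr _) (lin_comp phiA_linear (amul_linr _)).
  by move=> c2 b2; exact: pair_at_represents.
(* The counit arises here: phiC(S_B(u')S_B(S_C(v))) = phiC(v S_B(u')) = phiB(S_C(v)u'). *)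
rewrite !diamond_pure -phiC_modularE phi_exchange counit_pure.
by rewrite mulrA mulrC [phiC _ * _]mulrC.
Qed.

Lemma dual_mul_diamond u v u' v' a :
  dual_mul (phiA phiB phiC) (coproduct E)
    (diamond SB SC phiB phiC u v) (diamond SB SC phiB phiC u' v') a
  = counit SC phiB (v ⊗ u') * diamond SB SC phiB phiC u v' a.
Proof.
have rep x y : represents (phiA phiB phiC)
    (representative (phiA phiB phiC) (diamond SB SC phiB phiC x y))
    (diamond SB SC phiB phiC x y).
  have [p hp] := diamond_in_dual ndB idC hE phiB hC x y.
  (* The default value 0 of [representative] is excluded by the witness [p]. *)
  by rewrite /representative; case: xgetP => [q _ hq | /(_ p)]; first exact: hq.
exact: pair_at_represents2.
Qed.

End SeparabilityFunctionals.

Theorem proposition3p2 (R : realType) (B C : nuAlgType R[i])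
    (ndB : nondegenerate_algebra B) (idB : idempotent_algebra B)
    (ndC : nondegenerate_algebra C) (idC : idempotent_algebra C)
    (E : multiplier (B ⊗ C)) (SB : B -> C) (SC : C -> B)
    (hE : regular_separability_idempotent E SB SC)
    (phiB : {scalar B}) (phiC : {scalar C})
    (hB : is_phiB E phiB) (hC : is_phiC E phiC)
    (u u' : B) (v v' : C) :
  forall a : C ⊗ B,
  dual_mul (phiA phiB phiC) (coproduct E)
    (diamond SB SC phiB phiC u v) (diamond SB SC phiB phiC u' v') a
  = counit SC phiB (v ⊗ u') * diamond SB SC phiB phiC u v' a.
Proof. by move=> a; exact: (dual_mul_diamond ndB idB ndC idC hE hB hC). Qed.
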